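(* Let $0<\alpha<1$, $T>0$, $h>0$, and let $f$ be a function satisfying $$\int_{-\infty}^\infty f(x,t)\,dx=\frac{t^{-\alpha}}{\Gamma(1-\alpha)},$$ with $$\|f^n\|_{1,h}=\frac{t_n^{-\alpha}}{\Gamma(1-\alpha)}+\rho(h)$$ for every $n\ge1$ for which $f^n$ enters the scheme below, with quadrature error $\rho(h)$ (independent of $n$). Let $u_i^n$, for $t_n=nh\le T$, be given by the scheme $$u^n_{i\mp1}=\sum_{j=0}^{n-1}(b_{n-j}-b_{n-j+1})\,u^j_{i\mp(n-j+1)}+h^\alpha\,\Gamma(2-\alpha)\,f_i^{n+1},\qquad u_i^0=\psi(x_i),\qquad i\in\mathbb{Z},$$ where $b_k=k^{1-\alpha}-(k-1)^{1-\alpha}$ and $\psi$ is the given initial datum. Then, provided that $\|u^0\|_{1,h}=1$, we have $$\|u^n\|_{1,h}\le1+T\,\Gamma(2-\alpha)\,h^{\alpha-1}\rho(h).$$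
   Context: The mesh is $x_i=ih$, $t_n=nh$ ($i\in\mathbb{Z}$, $n\in\mathbb{N}$), with the same step in space and time. $f_i^n$ are the discrete values of $f$ on the mesh at time $t_n$ (cell averages $\frac1h\int_{x_i-h/2}^{x_i+h/2}f(x,t_n)\,dx$, or point values $f(x_i,t_n)$ for continuous $f$). The discrete norm is $\|v\|_{p,h}=\left(h\sum_{i\in\mathbb{Z}}|v_i|^p\right)^{1/p}$. Upper signs are taken together, and lower signs are taken together. The scheme is a modified discretization (source evaluated one step ahead) of the probability density problem $\left(\partial_t\pm\partial_x\right)^\alpha u=f$, $u(x,0)=\delta(x)$, with $\psi$ an approximation of the Dirac delta; here $\left(\partial_t\pm\partial_x\right)^\alpha u(x,t)=\frac{1}{\Gamma(1-\alpha)}(\partial_t\pm\partial_x)\int_0^t(t-s)^{-\alpha}u(x\mp(t-s),s)\,ds$.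
   Formalization: The quadrature error is additionally assumed to satisfy ρ(h) ≥ 0 when f^n are point values or when T < h; for ρ(h) < 0 the claimed bound already fails at n = 0, since ‖u^0‖ = 1. *)

(* Defs.v *)
From HB Require Import structures.
From mathcomp Require Import all_boot all_order all_algebra.
From mathcomp Require Import all_classical all_reals all_analysis.
Set Implicit Arguments.
Unset Strict Implicit.
Unset Printing Implicit Defensive.
Import Order.TTheory GRing.Theory Num.Theory.
Import numFieldNormedType.Exports.
Local Open Scope classical_set_scope.
Local Open Scope ring_scope.

(* Euler's Gamma function, meaningful for a > 0. *)
Definition Gamma (R : realType) (a : R) : R :=
  \int[lebesgue_measure]_(x in `]0, +oo[) (x `^ (a - 1) * expR (- x)).

Definition mesh_point (R : realType) (h : R) (i : int) : R := i%:~R * h.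

Definition mesh_time (R : realType) (h : R) (n : nat) : R := n%:R * h.

(* Extended-real valued: it is +oo when the series diverges. *)
Definition discrete_norm (R : realType) (p h : R) (v : int -> R) : \bar R :=
  (h%:E * \esum_(i in [set: int]) (`|v i| `^ p)%:E)%E `^ p^-1.

Inductive sampling : Set := CellAverages | PointValues.

(* The values f_i^n of f on the mesh; f takes the space variable first. *)
Definition discretize (R : realType) (s : sampling) (h : R) (f : R -> R -> R)
    (n : nat) (i : int) : R :=
  let x := mesh_point h i in
  let t := mesh_time h n in
  match s with
  | CellAverages =>
      h^-1 * \int[lebesgue_measure]_(y in `[x - h / 2, x + h / 2]) f y t
  | PointValues => f x t
  end.

(* Meaningful for 1 <= k. *)
Definition weight (R : realType) (alpha : R) (k : nat) : R :=
  k%:R `^ (1 - alpha) - (k%:R - 1) `^ (1 - alpha).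

(* The sign e is 1 for the upper signs and -1 for the lower ones; F n i is
   f_i^n.  At n = 0 the equation is replaced by the initial condition. *)
Definition scheme (R : realType) (e : int) (alpha T h : R)
    (F : nat -> int -> R) (psi : R -> R) (u : nat -> int -> R) : Prop :=
  (forall i : int, u 0%N i = psi (mesh_point h i)) /\
  (forall (n : nat) (i : int), (0 < n)%N -> mesh_time h n <= T ->
     u n (i - e) =
       \sum_(j < n) (weight alpha (n - j) - weight alpha (n - j + 1)) *
                    u j (i - e * (n - j + 1)%N%:Z)
       + h `^ alpha * Gamma (2 - alpha) * F n.+1 i).

(* Main.v *)
Require Import Defs.
From HB Require Import structures.
From mathcomp Require Import all_boot all_order all_algebra.
From mathcomp Require Import all_classical all_reals all_analysis.
From mathcomp Require Import measurable_realfun ring lra.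
Set Implicit Arguments.
Unset Strict Implicit.
Unset Printing Implicit Defensive.
Import Order.TTheory GRing.Theory Num.Theory.
Import numFieldNormedType.Exports.
Local Open Scope classical_set_scope.
Local Open Scope ring_scope.

(* Translations of the mesh preserve the discrete L1 norm, so the triangle
   inequality turns the scheme into a scalar recursion for the norms of u^n:
   the weights b_(n-j) - b_(n-j+1) are nonnegative (x |-> x^(1-alpha) is
   concave) and sum to 1 - b_(n+1), while the source contributes
   (1-alpha) (n+1)^(-alpha) <= b_(n+1) plus c = h^alpha Gamma(2-alpha) rho(h).
   By induction the norm of u^n is at most 1 + n c, and n h <= T.  The
   induction needs rho(h) >= 0; for cell averages this holds because the norm
   of the averages dominates the integral of f. *)

(** * Concavity of the power function and the weights *)

(** A concave graph lies below its tangents. Substituting [x = y * expR s] turns this into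
    [expR (b * s) <= 1 + b * (expR s - 1)]. The value [x = 0] has no logarithm and is treated apart;
    the first weight, with [k - 1 = 0], uses it. *)
Lemma powR_tangent (R : realType) (b x y : R) :
  0 < b -> b < 1 -> 0 <= x -> 0 < y ->
  x `^ b <= y `^ b + b * y `^ (b - 1) * (x - y).
Proof.
move=> b0 b1 x0 y0.
have e1 : y `^ (b - 1) = y `^ b / y.
  by rewrite powRB ?powRr1 ?ltW// (gt_eqF y0) implybT.
move: x0; rewrite le_eqVlt => /predU1P[<-|x0].
  rewrite powR0 ?gt_eqF// sub0r mulrN e1 mulrA mulfVK ?gt_eqF//.
  by have := powR_ge0 y b; nra.
have xy0 : 0 < x / y by rewrite divr_gt0.
pose s := ln (x / y).
have E1 : x = y * expR s by rewrite lnK ?posrE// mulrC divfK// gt_eqF.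
have E2 : x `^ b = y `^ b * expR (b * s).
  rewrite {1}E1 powRM ?expR_ge0 ?(ltW y0)//.
  by rewrite {2}/powR gt_eqF ?expR_gt0// expRK.
have E3 : b * (y `^ b / y) * (x - y) = y `^ b * (b * (expR s - 1)).
  by rewrite [in X in _ * (X - _) = _]E1; field; rewrite gt_eqF.
rewrite e1 E2 E3 -[X in _ <= X + _]mulr1 -mulrDr ler_wpM2l ?powR_ge0//.
(* The two exponential bounds, weighted by b and 1 - b, are added. *)
have A := expR_ge1Dx ((1 - b) * s); have B := expR_ge1Dx (- (b * s)).
have -> : expR s = expR (b * s) * expR ((1 - b) * s).
  by rewrite -expRD; congr expR; ring.
have C : expR (b * s) * expR (- (b * s)) = 1 by rewrite -expRD subrr expR0.
have P := expR_gt0 (b * s).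
set E := expR (b * s) in C P *; set G := expR ((1 - b) * s) in A *.
set H := expR (- (b * s)) in B C.
have : 0 <= E * (b * (G - (1 + (1 - b) * s)) + (1 - b) * (H - (1 - b * s))).
  apply: mulr_ge0; first exact: ltW.
  by apply: addr_ge0; apply: mulr_ge0; lra.
(* The terms linear in [s] cancel and the constants add up to 1. *)
have -> : E * (b * (G - (1 + (1 - b) * s)) + (1 - b) * (H - (1 - b * s)))
  = b * (E * G) + (1 - b) * (E * H) - E by ring.
rewrite C; lra.
Qed.

(** Tangent at [k], evaluated at [k - 1]. Evaluated at [k + 1] it gives the next lemma, so the slope
    at [k] separates two consecutive weights. *)
Lemma weight_ge (R : realType) (alpha : R) (k : nat) :
  0 < alpha -> alpha < 1 -> (0 < k)%N ->
  (1 - alpha) * k%:R `^ (- alpha) <= weight alpha k.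
Proof.
move=> a0 a1 k0; have k0' : 0 < k%:R :> R by rewrite ltr0n.
have k1 : 0 <= k%:R - 1 :> R by rewrite subr_ge0 ler1n.
have := @powR_tangent R (1 - alpha) (k%:R - 1) k%:R.
rewrite subr_gt0 /weight (_ : 1 - alpha - 1 = - alpha); last by ring.
move=> /(_ a1) H; have := H _ k1 k0'; lra.
Qed.

Lemma weightS_le (R : realType) (alpha : R) (k : nat) :
  0 < alpha -> alpha < 1 -> (0 < k)%N ->
  weight alpha k.+1 <= (1 - alpha) * k%:R `^ (- alpha).
Proof.
move=> a0 a1 k0; have k0' : 0 < k%:R :> R by rewrite ltr0n.
have := @powR_tangent R (1 - alpha) k.+1%:R k%:R.
rewrite subr_gt0 /weight (_ : 1 - alpha - 1 = - alpha); last by ring.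
move=> /(_ a1) H; have := H _ (ler0n _ _) k0'; rewrite -natr1 addrK; lra.
Qed.

Lemma weight_noninc (R : realType) (alpha : R) (k : nat) :
  0 < alpha -> alpha < 1 -> (0 < k)%N -> weight alpha k.+1 <= weight alpha k.
Proof.
move=> a0 a1 k0; apply: le_trans (weight_ge _ _ _) => //; exact: weightS_le.
Qed.

Lemma weight1 (R : realType) (alpha : R) : alpha < 1 -> weight alpha 1 = 1.
Proof.
by move=> a1; rewrite /weight subrr powR1 powR0 ?subr0// subr_eq0 gt_eqF.
Qed.

Lemma sum_weight (R : realType) (alpha : R) (n : nat) : alpha < 1 ->
  \sum_(j < n) (weight alpha (n - j) - weight alpha (n - j + 1))
    = 1 - weight alpha n.+1.
Proof.
move=> a1; rewrite -(weight1 a1).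
rewrite -(big_mkord xpredT
  (fun j => weight alpha (n - j) - weight alpha (n - j + 1))).
(* The sum telescopes from [weight alpha n.+1] at [j = 0] up to [weight alpha 1 = 1] at [j = n]. *)
rewrite (@telescope_sumr_eq _ _ _ (fun j => weight alpha (n - j + 1))) //.
  by rewrite subnn subn0 !addn1.
by move=> j /andP[_ jn]; rewrite subnS !addn1 prednK// subn_gt0.
Qed.

(** * The discrete L1 norm as an extended-real seminorm *)

Lemma esum_scale_le (R : realType) (T : choiceType) (c : R) (a : T -> \bar R) :
  0 <= c -> (forall i, (0 <= a i)%E) ->
  (\esum_(i in [set: T]) (c%:E * a i) <= c%:E * \esum_(i in [set: T]) a i)%E.
Proof.
move=> c0 a0; apply: ge_ereal_sup => _ [X XT <-].
have [finX _] := XT.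
rewrite -ge0_mule_fsumr//; apply: lee_wpmul2l; first by rewrite lee_fin.
by apply: esum_ge; exists X.
Qed.

Lemma discrete_norm1E (R : realType) (h : R) (v : int -> R) : 0 <= h ->
  (discrete_norm 1 h v = h%:E * \esum_(i in [set: int]) `|v i|%:E)%E.
Proof.
move=> h0; rewrite /discrete_norm invr1 poweRe1.
  by congr (_ * _)%E; apply: eq_esum => i _; rewrite powRr1.
by rewrite mule_ge0// esum_ge0// => i _; rewrite lee_fin powR_ge0.
Qed.

Lemma discrete_norm_translate (R : realType) (p h : R) (k : int)
    (v : int -> R) :
  discrete_norm p h (fun i => v (i + k)) = discrete_norm p h v.
Proof.
rewrite /discrete_norm; congr (poweR (_ * _)%E _).
rewrite [RHS](@reindex_esum R int int setT setT (fun i => i + k))//.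
split=> //; first by move=> i j _ _; exact: addIr.
by move=> i _; exists (i - k) => //; rewrite subrK.
Qed.

Lemma discrete_norm1_0 (R : realType) (h : R) :
  0 <= h -> (discrete_norm 1 h (fun=> 0%R) = 0)%E.
Proof.
by move=> h0; rewrite discrete_norm1E// esum1 ?mule0// => i _; rewrite normr0.
Qed.

Lemma discrete_norm1D (R : realType) (h : R) (v w : int -> R) : 0 <= h ->
  (discrete_norm 1 h (fun i => v i + w i)%R
    <= discrete_norm 1 h v + discrete_norm 1 h w)%E.
Proof.
move=> h0; rewrite !discrete_norm1E// -ge0_muleDr ?esum_ge0//.
rewrite -esumD//; apply: lee_wpmul2l => //.
by apply: le_esum => i _; rewrite -EFinD lee_fin ler_normD.
Qed.

Lemma discrete_norm1Z (R : realType) (h c : R) (v : int -> R) : 0 <= h ->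
  0 <= c ->
  (discrete_norm 1 h (fun i => c * v i)%R <= c%:E * discrete_norm 1 h v)%E.
Proof.
move=> h0 c0; rewrite !discrete_norm1E// muleCA lee_wpmul2l//.
apply: le_trans (esum_scale_le c0 _); last by move=> i; rewrite lee_fin.
by apply: le_esum => i _; rewrite normrM (ger0_norm c0) EFinM.
Qed.

Lemma discrete_norm1_sum (R : realType) (h : R) (n : nat) (c : 'I_n -> R)
    (v : 'I_n -> int -> R) :
  0 <= h -> (forall j, 0 <= c j) ->
  (discrete_norm 1 h (fun i => \sum_(j < n) c j * v j i)%R
    <= \sum_(j < n) ((c j)%:E * discrete_norm 1 h (v j)))%E.
Proof.
move=> h0; elim: n c v => [|n IH] c v c0.
  rewrite big_ord0 -(discrete_norm1_0 h0) le_eqVlt; apply/orP; left.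
  by apply/eqP; congr discrete_norm; apply/funext => i; rewrite big_ord0.
rewrite big_ord_recr/=; under eq_fun do rewrite big_ord_recr/=.
apply: le_trans (discrete_norm1D _ _ h0) _; apply: leeD.
  exact: (IH (fun j => c (widen_ord (leqnSn n) j))
             (fun j => v (widen_ord (leqnSn n) j))).
exact: discrete_norm1Z.
Qed.

(** * Splitting an integral along the mesh cells *)

(** Lists the integers as 0, -1, 1, -2, 2, ..., so that countable additivity, stated for sequences
    of sets, applies to the mesh cells. *)
Definition int_of_nat_bij (n : nat) : int :=
  if odd n then Negz n./2 else Posz n./2.

Lemma int_of_nat_bijP : set_bij setT setT int_of_nat_bij.
Proof.
have iK : cancel int_of_nat_bij
    (fun z => match z with Posz k => k.*2 | Negz k => k.*2.+1 end).
  rewrite /int_of_nat_bij => n.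
  by case: ifP => on; rewrite -[in RHS](odd_double_half n) on.
split=> //; first by move=> m n _ _; exact: (can_inj iK).
move=> [k|k] _; [exists k.*2|exists k.*2.+1] => //.
  by rewrite /int_of_nat_bij odd_double doubleK.
by rewrite /int_of_nat_bij /= odd_double/= uphalf_double.
Qed.

(* Half-open, so that the cells partition the line. *)
Definition mesh_cell (R : realType) (h : R) (i : int) : set R :=
  `[mesh_point h i - h / 2, mesh_point h i + h / 2[%classic.

(** Since each point determines its cell index by a formula, covering and disjointness of the cells
    both follow. *)
Lemma mesh_cellP (R : realType) (h : R) (i : int) (x : R) : 0 < h ->
  mesh_cell h i x <-> Num.floor (x / h + 2^-1) = i.
Proof.
move=> h0; rewrite /mesh_cell /mesh_point /= in_itv/=; split.
  move=> /andP[A B]; apply: floor_def.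
  rewrite intrD -(ler_pM2r h0) -(ltr_pM2r h0) !mulrDl mulfVK ?gt_eqF//.
  apply/andP; split; lra.
move=> <-; have := floor_itv (x / h + 2^-1).
rewrite intrD -(ler_pM2r h0) -(ltr_pM2r h0) !mulrDl mulfVK ?gt_eqF//.
move=> /andP[A B]; apply/andP; split; lra.
Qed.

Lemma integral_mesh_le (R : realType) (h : R) (g : R -> R) : 0 < h ->
  lebesgue_measure.-integrable setT (EFin \o g) ->
  (`|\int[lebesgue_measure]_(x in setT) (g x)%:E| <=
   \esum_(i in [set: int])
     `|\int[lebesgue_measure]_(x in mesh_cell h i) (g x)%:E|)%E.
Proof.
move=> h0 ig; have [_ ei es] := int_of_nat_bijP.
pose F n := mesh_cell h (int_of_nat_bij n).
have mF n : measurable (F n) by exact: measurable_itv.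
have FT : \bigcup_n F n = setT.
  apply/seteqP; split=> // x _.
  have [n _ en] := es (Num.floor (x / h + 2^-1)) I.
  by exists n => //; apply/mesh_cellP.
have tF : trivIset setT F.
  apply/trivIsetP => m n _ _ /eqP mn; rewrite -subset0 => x [].
  move=> /(mesh_cellP _ _ h0) Em /(mesh_cellP _ _ h0) En; apply: mn.
  by apply: ei; rewrite ?inE// -Em.
rewrite (reindex_esum _ _ _ _ int_of_nat_bijP) -nneseries_esumT//.
rewrite -[in leLHS]FT integral_bigcup ?FT//.
pose a n := (\int[lebesgue_measure]_(x in F n) (g x)%:E)%E.
(* The cell integrals are signed; integrability of [g] makes them summable, so their series is a
   difference of two nonnegative ones, whose sum is the series of absolute values. *)
have aE : (\sum_(i <oo) a i = \sum_(i <oo) a^\+ i - \sum_(i <oo) a^\- i)%E.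
  apply: summable_eseries.
  rewrite (_ : (fun=> is_true true) = [set: nat]); last exact/seteqP.
  by apply: integrable_summable => //; rewrite FT.
rewrite -/(a _) aE; apply: le_trans (lee_abs_sub _ _) _.
rewrite !gee0_abs; try by apply: nneseries_ge0.
rewrite -nneseriesD//; apply: lee_nneseries => [n _ _|n _].
  by rewrite adde_ge0.
rewrite -/(a n) (_ : `|a n| = a^\+ n + a^\- n)%E//.
by rewrite -[LHS]/((abse \o a) n) fune_abse.
Qed.

(** * The functional equation of Gamma, as an upper bound *)

Lemma gamma_parts_le (R : realType) (b x y : R) :
  0 < b -> 0 < x -> x < y ->
  (\int[lebesgue_measure]_(t in `[x, y]) (t `^ b * expR (- t))%:E
   <= b%:E * \int[lebesgue_measure]_(t in `[x, y]) (t `^ (b - 1) * expR (- t))%:E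
      + (x `^ b)%:E)%E.
Proof.
move=> b0 x0 xy.
have dP c (t : R) : 0 < t -> derivable (fun s : R => s `^ c) t 1.
  by move=> t0; apply: ex_derive; exact: is_derive1_powR.
have dE (t : R) : is_derive t 1 (fun s : R => - expR (- s)) (expR (- t)).
  apply: is_derive_eq; rewrite /GRing.scale/=; ring.
have dc (F : R -> R) : (forall t, x <= t -> derivable F t 1) ->
    derivable_oo_LRcontinuous F x y.
  move=> dF; have cF t : x <= t -> {for t, continuous F}.
    by move=> xt; apply/differentiable_continuous/derivable1_diffP/dF.
  split.
  - by move=> t; rewrite in_itv/= => /andP[/ltW xt _]; exact: dF.
  - by apply: cvg_at_right_filter; apply: cF.
  - by apply: cvg_at_left_filter; apply: cF; exact: ltW.
rewrite (@integration_by_parts R (fun s => s `^ b) (fun s => - expR (- s))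
  (fun s => b * s `^ (b - 1)) (fun s => expR (- s)))//.
- rewrite (_ : (fun t => _) =
      fun t => ((- b)%:E * (t `^ (b - 1) * expR (- t))%:E)%E); last first.
    by apply/funext => t; rewrite -EFinM; congr EFin; ring.
  rewrite integralZl//; last first.
    apply: continuous_compact_integrable; first exact: segment_compact.
    apply: derivable_within_continuous => t; rewrite in_itv/= => /andP[xt _].
    apply: derivableM; last exact: ex_derive.
    by apply: dP; exact: lt_le_trans xt.
  rewrite EFinN mulNe oppeK addeC leeD2l// lee_fin.
  have e1 : expR (- x) <= 1 by rewrite -expR0 ler_expR oppr_le0 ltW.
  have := powR_ge0 x b; have := mulr_ge0 (powR_ge0 y b) (expR_ge0 (- y)).
  nra.
- apply: derivable_within_continuous => t; rewrite in_itv/= => /andP[xt _].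
  by apply: derivableM => //; apply: dP; exact: lt_le_trans xt.
- by apply: dc => t xt; apply: dP; exact: lt_le_trans xt.
- move=> t; rewrite in_itv/= => /andP[xt _].
  by rewrite powR_derive1// in_itv/= andbT (lt_trans x0).
- by apply: derivable_within_continuous => t _; apply: ex_derive.
- by apply: dc => t _; apply: ex_derive.
- by move=> t _; rewrite derive1E derive_val.
Qed.

(** Monotone convergence along compact intervals exhausting the half-line; both integrals may be
    infinite. *)
Lemma gamma_integral_le (R : realType) (b : R) : 0 < b ->
  (\int[lebesgue_measure]_(t in `]0%R, +oo[) (t `^ b * expR (- t))%:E
   <= b%:E *
      \int[lebesgue_measure]_(t in `]0%R, +oo[) (t `^ (b - 1) * expR (- t))%:E)%E.
Proof.
move=> b0.
(* Starting at 2 keeps the left end strictly below the right one, even for [n = 0]. *)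
pose F n : set R := `[(n.+2%:R)^-1, n.+2%:R]%classic.
have FU : \bigcup_n F n = `]0%R, +oo[%classic.
  apply/seteqP; split=> t; rewrite /F /= in_itv/= andbT.
    by case=> n _ /=; rewrite in_itv/= => /andP[H _]; exact: lt_le_trans H.
  move=> t0; pose m := (Num.truncn t + Num.truncn t^-1)%N.
  have := truncnS_gt t; have := truncnS_gt t^-1 => H1 H2.
  exists m => //=; rewrite in_itv/=; apply/andP; split.
    rewrite -[leRHS]invrK lef_pV2 ?posrE ?invr_gt0//.
    by apply: le_trans (ltW H1) _; rewrite ler_nat /m !ltnS ltnW// ltnS leq_addl.
  by apply: le_trans (ltW H2) _; rewrite ler_nat /m !ltnS ltnW// ltnS leq_addr.
have ndF : nondecreasing_seq F.
  apply/nondecreasing_seqP => n; apply/subsetPset => t.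
  rewrite /F /= !in_itv/= => /andP[A B]; apply/andP; split.
    by apply: le_trans A; rewrite lef_pV2 ?posrE ?ler_nat.
  by apply: le_trans B _; rewrite ler_nat.
have mF n : measurable (F n) by exact: measurable_itv.
have mI c : measurable_fun [set: R] (fun t : R => t `^ c * expR (- t)).
  apply: measurable_funM; first exact: measurable_powR.
  by apply: measurableT_comp => //; exact: measurableT_comp.
have cvI c : (\int[lebesgue_measure]_(t in F n) (t `^ c * expR (- t))%:E
    @[n --> \oo] -->
    \int[lebesgue_measure]_(t in `]0%R, +oo[) (t `^ c * expR (- t))%:E)%E.
  rewrite -FU; apply: ge0_nondecreasing_set_cvg_integral => // n.
    apply: (measurable_funS measurableT (@subsetT _ _)).
    by apply/measurable_EFinP; exact: mI.
  by move=> t _; rewrite lee_fin mulr_ge0 ?powR_ge0 ?expR_ge0.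
(* The boundary term vanishes in the limit because [b > 0]. *)
have cve : ((n.+2%:R : R)^-1 `^ b @[n --> \oo] --> (0 : R)).
  have [+ _] := cvg_at_rightP (fun t : R => t `^ b) 0 0.
  move=> /(_ (powR_cvg0 b0)); apply; split; first by move=> n; rewrite invr_gt0.
  by have := @cvg_harmonic R; rewrite -cvg_shiftS.
have cvr : (b%:E * \int[lebesgue_measure]_(t in F n)
     (t `^ (b - 1) * expR (- t))%:E + ((n.+2%:R : R)^-1 `^ b)%:E
   @[n --> \oo] --> b%:E *
  \int[lebesgue_measure]_(t in `]0%R, +oo[) (t `^ (b - 1) * expR (- t))%:E)%E.
  rewrite -[X in _ --> X]adde0; apply: cvgeD.
  - by rewrite fin_num_adde_defl.
  - by apply: cvgeZl.
  - by apply/fine_cvgP; split; [exact: nearW|].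
rewrite -(cvg_lim _ (cvI b))// -(cvg_lim _ cvr)//; apply: lee_lim.
- by apply/cvg_ex; eexists; exact: cvI.
- by apply/cvg_ex; eexists; exact: cvr.
- apply: nearW => n; apply: gamma_parts_le => //.
  by rewrite (@lt_le_trans _ _ 1)// ?invf_lt1 ?ltr1n ?ler1n.
Qed.

(* An equality, but the upper bound needs no convergence of the integral: if it
   diverges, the junk value Gamma b = 0 makes the quotient 0. *)
Lemma GammaS_le (R : realType) (b : R) : 0 < b ->
  Gamma (b + 1) / Gamma b <= b.
Proof.
move=> b0.
have G0 c : 0 <= Gamma c :> R.
  by apply: Rintegral_ge0 => t _; rewrite mulr_ge0 ?powR_ge0 ?expR_ge0.
have := G0 b; rewrite le_eqVlt => /predU1P[<-|Gb].
  by rewrite invr0 mulr0 ltW.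
rewrite ler_pdivrMr//.
(* [fine] sends infinite values to 0, so [0 < fine I] forces [I] to be finite, and then [J], between
   0 and [b * I], is finite too. *)
have fine_le (I J : \bar R) : (0 <= J)%E -> (J <= b%:E * I)%E ->
    0 < fine I -> fine J <= b * fine I.
  by case: I => [x| |]; rewrite ?ltxx//; case: J.
rewrite {1}/Gamma addrK; apply: fine_le Gb; last exact: gamma_integral_le.
by apply: integral_ge0 => t _; rewrite lee_fin mulr_ge0 ?powR_ge0 ?expR_ge0.
Qed.

(** * Sign of the quadrature error and the stability bound *)

(** The factor [h] of the norm cancels the [h^-1] of the averages, which leaves the sum of the
    absolute cell integrals. *)
Lemma cell_averages_norm_ge (R : realType) (h : R) (f : R -> R -> R) (n : nat) :
  0 < h ->
  lebesgue_measure.-integrable setT (fun x : R => (f x (mesh_time h n))%:E) ->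
  (`|\int[lebesgue_measure]_(x in [set: R]) f x (mesh_time h n)|%:E
    <= discrete_norm 1 h (discretize CellAverages h f n))%E.
Proof.
move=> h0 fi; rewrite EFin_normr_Rintegral//.
apply: le_trans (integral_mesh_le h0 fi) _; rewrite discrete_norm1E ?(ltW h0)//.
apply: le_trans (esum_scale_le (ltW h0) _) => //.
apply: le_esum => i _.
have ci : lebesgue_measure.-integrable (mesh_cell h i)
    (EFin \o (fun x : R => f x (mesh_time h n))).
  by apply: integrableS fi => //; exact: measurable_itv.
rewrite -EFin_normr_Rintegral//; last exact: measurable_itv.
rewrite -EFinM lee_fin /discretize normrM (@gtr0_norm _ h^-1) ?invr_gt0// mulVKf ?gt_eqF//.
(* Averages use closed cells and the partition half-open ones; they differ by a null set. *)
by rewrite -Rintegral_itv_bndo_bndc.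
Qed.

Theorem theorem4 (R : realType) (e : int) (he : e = 1 \/ e = -1)
    (alpha T h : R) (halpha0 : 0 < alpha) (halpha1 : alpha < 1)
    (hT : 0 < T) (hh : 0 < h)
    (f : R -> R -> R)
    (hfint : forall t : R, 0 < t ->
       lebesgue_measure.-integrable setT (fun x : R => (f x t)%:E))
    (hf : forall t : R, 0 < t ->
       \int[lebesgue_measure]_(x in [set: R]) f x t
         = t `^ (- alpha) / Gamma (1 - alpha))
    (s : sampling)
    (hs : s = PointValues ->
       forall t : R, 0 < t -> continuous (fun x : R => f x t))
    (rho : R -> R)
    (hnormf : forall n : nat, (0 < n)%N -> mesh_time h n <= T ->
       discrete_norm 1 h (discretize s h f n.+1)
         = (mesh_time h n.+1 `^ (- alpha) / Gamma (1 - alpha) + rho h)%:E)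
    (* for cell averages and h <= T, rho h >= 0 follows from hf and hnormf *)
    (hrho : s = PointValues \/ T < h -> 0 <= rho h)
    (psi : R -> R) (u : nat -> int -> R)
    (hu : scheme e alpha T h (discretize s h f) psi u)
    (hu0 : discrete_norm 1 h (u 0%N) = 1%:E) :
  forall n : nat, mesh_time h n <= T ->
    (discrete_norm 1 h (u n)
       <= (1 + T * Gamma (2 - alpha) * h `^ (alpha - 1) * rho h)%:E)%E.
Proof.
have rho0 : 0 <= rho h.
  case: s hs hnormf hrho {hu} => _ hnormf hrho; last by apply: hrho; left.
  have [hT'|Th] := leP h T; last by apply: hrho; right.
  (* The first step, [n = 1], is in range, and its source sits at time [2 * h]: there the norm
     dominates the integral and exceeds it by exactly [rho h]. *)
  have h1T : mesh_time h 1 <= T by rewrite /mesh_time mul1r.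
  have t2 : 0 < mesh_time h 2 by rewrite mulr_gt0.
  have := cell_averages_norm_ge hh (hfint _ t2).
  rewrite hf// hnormf// lee_fin => /(le_trans (ler_norm _)).
  by rewrite lerDl.
have G0 (b : R) : 0 <= Gamma b.
  by apply: Rintegral_ge0 => t _; rewrite mulr_ge0 ?powR_ge0 ?expR_ge0.
pose K := h `^ alpha * Gamma (2 - alpha).
have K0 : 0 <= K by rewrite mulr_ge0 ?powR_ge0.
(* The source at time level [n.+1] is matched with [weight alpha n.+1], exactly the mass that the
   coefficients of step [n] lack to sum to 1. The powers of [h] cancel. *)
have source n : K * (mesh_time h n.+1 `^ (- alpha) / Gamma (1 - alpha))
    <= weight alpha n.+1.
  apply: le_trans (weight_ge halpha0 halpha1 (ltn0Sn n)).
  have GS : Gamma (2 - alpha) / Gamma (1 - alpha) <= 1 - alpha.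
    rewrite (_ : 2 - alpha = 1 - alpha + 1); last by ring.
    by apply: GammaS_le; rewrite subr_gt0.
  rewrite /mesh_time powRM ?(ltW hh)//.
  have -> : K * (n.+1%:R `^ (- alpha) * h `^ (- alpha) / Gamma (1 - alpha)) =
      h `^ alpha * h `^ (- alpha) *
      (Gamma (2 - alpha) / Gamma (1 - alpha) * n.+1%:R `^ (- alpha)).
    by rewrite /K; ring.
  rewrite powRN divff ?mul1r ?gt_eqF ?powR_gt0//.
  by apply: ler_wpM2r; rewrite ?powR_ge0.
pose c := K * rho h.
have c0 : 0 <= c by rewrite mulr_ge0.
have bound n : mesh_time h n <= T ->
    (discrete_norm 1 h (u n) <= (1 + n%:R * c)%:E)%E.
  elim/ltn_ind: n => -[|n] IH nT; first by rewrite hu0 mul0r addr0.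
  have w0 (j : 'I_n.+1) :
      0 <= weight alpha (n.+1 - j) - weight alpha (n.+1 - j + 1).
    by rewrite addn1 subr_ge0 weight_noninc// subn_gt0.
  (* The scheme gives the new level at [i - e], so the norm is first shifted to these points. *)
  rewrite -(discrete_norm_translate 1 h (- e)).
  under eq_fun do rewrite (hu.2 _ _ (ltn0Sn n) nT).
  apply: le_trans (discrete_norm1D _ _ (ltW hh)) _.
  apply: le_trans (leeD (discrete_norm1_sum _ (ltW hh) w0)
    (discrete_norm1Z _ (ltW hh) K0)) _.
  rewrite hnormf// -EFinM mulrDr -/c.
  (* As [c >= 0], one bound serves all earlier levels and factors out of the weighted sum. *)
  have IH' (j : 'I_n.+1) : (discrete_norm 1 h (u j) <= (1 + n%:R * c)%:E)%E.
    apply: le_trans (IH j (ltn_ord j) _) _.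
      by apply: le_trans nT; rewrite ler_pM2r// ler_nat ltnW.
    by rewrite lee_fin lerD2l ler_wpM2r// ler_nat -ltnS.
  apply: (@le_trans _ _ (\sum_(j < n.+1)
      (weight alpha (n.+1 - j) - weight alpha (n.+1 - j + 1))%:E *
      (1 + n%:R * c)%:E + (weight alpha n.+2 + c)%:E)%E).
    apply: leeD; last by rewrite lee_fin lerD2r.
    apply: lee_sum => j _; rewrite discrete_norm_translate.
    by apply: lee_wpmul2l; rewrite ?lee_fin.
  under eq_bigr do rewrite -EFinM.
  rewrite sumEFin -EFinD lee_fin -mulr_suml sum_weight// -[n.+1%:R]natr1.
  (* Writing [w] for this weight, the bound is [(1 - w) * (1 + n * c) + w + c], which is
     [1 + (n + 1) * c - w * n * c]. *)
  have b0 : 0 <= weight alpha n.+2.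
    apply: le_trans (weight_ge halpha0 halpha1 (ltn0Sn _)).
    by rewrite mulr_ge0 ?powR_ge0// subr_ge0 ltW.
  have := mulr_ge0 b0 (mulr_ge0 (ler0n R n) c0); lra.
move=> n nT; apply: le_trans (bound n nT) _; rewrite lee_fin lerD2l.
rewrite /c /K -(mulr_powRB1 (ltW hh) halpha0).
rewrite (_ : n%:R * _ =
  mesh_time h n * (Gamma (2 - alpha) * (h `^ (alpha - 1) * rho h))); last first.
  by rewrite /mesh_time; ring.
rewrite -[leRHS]mulrA -[leRHS]mulrA; apply: ler_wpM2r => //.
by rewrite !mulr_ge0 ?powR_ge0.
Qed.
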